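(* For every $m\in\mathbb{N}_{\ge2}\cup\{\infty\}$, the Sarnak property does not imply the Chowla property for sequences of index $m$: there exists a sequence $z\in(S^1\cup\{0\})^{\mathbb{N}}$ of index $m$ which is a Sarnak sequence but not a Chowla sequence.
   Context: $\mathbb{N}=\{0,1,2,\dots\}$, $\mathbb{N}_{\ge 2}=\mathbb{N}\setminus\{0,1\}$, and $S^1$ is the unit circle in $\mathbb{C}$. A sequence $(z(n))_{n\in\mathbb{N}}$ of complex numbers has the Sarnak property (is a Sarnak sequence) if for each homeomorphism $T$ of a compact metric space $X$ with topological entropy $h(T)=0$, one has $\lim_{N\to\infty}\frac1N\sum_{n=0}^{N-1}f(T^nx)z(n)=0$ for all continuous $f:X\to\mathbb{C}$ and all $x\in X$. For $m\in\mathbb{N}_{\ge2}$ let $U(m)=\{e^{2\pi i k/m}:0\le k\le m-1\}$, and $U(\infty)=S^1$. The index of a sequence $z=(z(n))_{n\in\mathbb{N}}\in(S^1\cup\{0\})^{\mathbb{N}}$ is the smallest $m\in\mathbb{N}_{\ge2}\cup\{\infty\}$ such that $\{n\in\mathbb{N}: z(n)\notin U(m)\cup\{0\}\}$ has density zero in $\mathbb{N}$, i.e. $\frac1N\#\{0\le n\le N-1: z(n)\notin U(m)\cup\{0\}\}\to0$. For $x\in S^1\cup\{0\}$ and $n\in\mathbb{Z}$, put $x^{(n)}=x^n$ if $x\in S^1$ and $x^{(n)}=0$ if $x=0$; write $z^{(i)}(n)=(z(n))^{(i)}$. Let $I(m)=\{0,1,\dots,m-1\}$ if $m\in\mathbb{N}_{\ge2}$,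 and $I(\infty)=\mathbb{Z}$. A sequence $z\in(S^1\cup\{0\})^{\mathbb{N}}$ of index $m$ has the Chowla property (is a Chowla sequence) if $$\lim_{N\to\infty}\frac1N\sum_{n=0}^{N-1} z^{(i_1)}(n+a_1)\,z^{(i_2)}(n+a_2)\cdots z^{(i_r)}(n+a_r)=0$$ for every $r\ge1$, all integers $0\le a_1<\dots<a_r$ and all $i_1,\dots,i_r\in I(m)$ not all equal to $0$. *)

(* Defs.v *)
From HB Require Import structures.
From mathcomp Require Import all_boot all_order all_algebra.
From mathcomp Require Import finmap.
From mathcomp Require Import all_classical all_reals all_analysis.
From mathcomp Require Import complex.

Set Implicit Arguments.
Unset Strict Implicit.
Unset Printing Implicit Defensive.

Import Order.TTheory GRing.Theory Num.Theory.
Import numFieldNormedType.Exports.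

Local Open Scope classical_set_scope.
Local Open Scope ring_scope.
Local Open Scope complex_scope.

(* In this file R[i] carries no topology of its own; the usual topology of the
   complex plane is the one on R[i]^o, which is convertible to R[i]. *)

Section Dynamics.
Context {R : realType} {X : metricType R}.

Definition homeomorphism (T : X -> X) : Prop :=
  exists S : X -> X,
    [/\ cancel T S, cancel S T, continuous T & continuous S].

(* F is (n, e)-spanning: it is e-dense for the Bowen metric
   max_(k < n) d (T^k x) (T^k y). *)
Definition spanning (T : X -> X) (n : nat) (e : R) (F : {fset X}) : Prop :=
  forall x : X, exists2 y : X, y \in F &
    forall k : nat, (k < n)%N -> mdist (iter k T x) (iter k T y) < e.

(* The logarithm of the least cardinality of an (n, e)-spanning set. *)
Definition log_spanning_number (T : X -> X) (n : nat) (e : R) : \bar R :=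
  ereal_inf [set (ln (#|` F|%:R : R))%:E | F in spanning T n e].

(* Bowen's definition of the topological entropy of a compact metric system.
   The exponential growth rate is nonincreasing in e, so its limit as
   e -> 0+ is the supremum over e > 0. *)
Definition topological_entropy (T : X -> X) : \bar R :=
  ereal_sup
    [set limn_esup (fun n => ((n%:R^-1)%:E * log_spanning_number T n e)%E)
    | e in [set e : R | 0 < e]].

End Dynamics.

Section Sequences.
Context {R : realType}.
Implicit Types (z : nat -> R[i]) (m : option nat).

(* The mean of the first N terms converges to 0; at N = 0 the mean is 0. *)
Definition mean_cvg0 (u : nat -> R[i]) : Prop :=
  (fun N : nat => (N%:R^-1 * \sum_(0 <= n < N) u n : R[i]^o)) @ \oo
    --> (0 : R[i]^o).

Definition sarnak z : Prop :=
  forall (X : metricType R) (T : X -> X),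
    compact [set: X] -> homeomorphism T -> topological_entropy T = 0%E ->
  forall f : X -> R[i]^o, continuous f ->
  forall x : X, mean_cvg0 (fun n => f (iter n T x) * z n).

(* Elements of {2, 3, ...} together with infinity are encoded in option nat:
   Some m stands for m and None for infinity. *)
Definition admissible m : Prop :=
  if m is Some m' then (2 <= m')%N else True.

Definition index_le m1 m2 : bool :=
  match m1, m2 with
  | _, None => true
  | None, Some _ => false
  | Some a, Some b => (a <= b)%N
  end.

Definition unit_circle : set R[i] := [set x | `|x| = 1].

(* The point exp (i t) of the unit circle. *)
Definition cexp (t : R) : R[i] := cos t +i* sin t.

Definition U m : set R[i] :=
  match m with
  | Some m' =>
      [set cexp (2 * pi * k%:R / m'%:R) | k in [set k : nat | (k < m')%N]]
  | None => unit_circle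
  end.

Definition density_zero (A : set nat) : Prop :=
  (fun N : nat => (#|[pred n : 'I_N | (n : nat) \in A]|%:R / N%:R : R)) @ \oo
    --> (0 : R).

Definition almost_in_U z m : Prop :=
  density_zero [set n | ~ (U m `|` [set 0]) (z n)].

Definition has_index z m : Prop :=
  [/\ admissible m, almost_in_U z m &
      forall m', admissible m' -> almost_in_U z m' -> index_le m m'].

(* Unlike x ^ n, this is 0 at x = 0 also when n = 0. *)
Definition cpow (x : R[i]) (n : int) : R[i] := if x == 0 then 0 else x ^ n.

Definition exponents m : set int :=
  match m with
  | Some m' => [set i : int | 0 <= i < m'%:Z]
  | None => setT
  end.

(* The Chowla property of a sequence z whose index is m. *)
Definition chowla m z : Prop :=
  forall (r : nat) (a : 'I_r -> nat) (i : 'I_r -> int),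
    (1 <= r)%N ->
    (forall j k : 'I_r, (j < k)%N -> (a j < a k)%N) ->
    (forall k, exponents m (i k)) ->
    (exists k, i k != 0) ->
  mean_cvg0 (fun n => \prod_(k < r) cpow (z (n + a k)%N) (i k)).

End Sequences.

(* Main.v *)
Require Import Defs.
From mathcomp Require Import all_boot all_order all_algebra.
From mathcomp Require Import finmap.
From mathcomp Require Import all_classical all_reals all_analysis.
From mathcomp Require Import complex.
From mathcomp Require Import ring lra zify.

(* Let omega be a primitive q-th root of unity and let w be the concatenation of
   blocks, the block of level L listing all q^L words of length L over
   {0, ..., q-1}, with L tending slowly to infinity. A zero-entropy orbit
   meets only e^(o(L)) words of length L up to a small error, whereas by a
   Chernoff bound each of these correlates with only an exponentially small
   proportion of the words of a block; hence omega^w is a Sarnak sequence. The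
   same holds for z(n) = c omega^(w(n/3)) with a constant c, since grouping the
   terms of an orbit by three preserves the bound on the number of words. As
   z(n) = z(n+1) for two thirds of the n, z(n) z(n+1)^(-1) does not have mean 0.
   For finite m take q = m and c = 1; for m = infinity take q = 2 and
   c = (3+4i)/5, which is not a root of unity. *)

Set Implicit Arguments.
Unset Strict Implicit.
Unset Printing Implicit Defensive.

Import Order.TTheory GRing.Theory Num.Theory.
Import numFieldNormedType.Exports.

Local Open Scope classical_set_scope.
Local Open Scope ring_scope.
Local Open Scope complex_scope.

(** * Base-[q] digits and sums of products over all words *)

Lemma sum_nat_mul (V : nmodType) (a b : nat) (F : nat -> V) :
  \sum_(0 <= n < a * b) F n =
  \sum_(0 <= v < a) \sum_(0 <= k < b) F (v * b + k)%N.
Proof.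
elim: a => [|a IH]; first by rewrite mul0n !big_nil.
rewrite big_nat_recr //= -IH mulSnr (big_cat_nat (leq0n (a * b)%N)) ?leq_addr //=.
congr (_ + _); rewrite -[X in index_iota X _]add0n big_addn addKn.
by apply: eq_bigr => k _; rewrite addnC.
Qed.

Definition digit (q v k : nat) : nat := ((v %/ q ^ k) %% q)%N.

(** The digits of a uniformly distributed [v < q ^ L] are independent, so the mean of a product
    factors. The induction splits off the lowest digit. *)
Lemma sum_prod_digit (R : comNzRingType) (q L : nat) (g : nat -> nat -> R) :
  (0 < q)%N ->
  \sum_(0 <= v < q ^ L) \prod_(0 <= k < L) g k (digit q v k) =
  \prod_(0 <= k < L) \sum_(0 <= d < q) g k d.
Proof.
move=> q0; elim: L g => [|L IH] g.
  by rewrite big_nat1 !big_nil.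
rewrite expnSr sum_nat_mul.
rewrite [RHS]big_nat_recl //= -(IH (fun k => g k.+1)) mulrC mulr_suml.
apply: eq_bigr => v _; rewrite mulr_sumr.
rewrite big_nat [RHS]big_nat; apply: eq_bigr => d /andP[_ dq].
rewrite big_nat_recl //= mulrC /digit expn0 divn1 modnMDl modn_small //.
congr (_ * _); apply: eq_bigr => k _.
by rewrite expnS divnMA divnMDl // (divn_small dq) addn0.
Qed.

(** * Chernoff bounds for deterministic sequences against the list of all words *)

Section DeterministicSequences.
Variable R : realType.
Implicit Types (a phi u : nat -> R) (q L : nat).

(** Convergence of the means to 0, written without division so that [N = 0] is harmless. *)
Definition sum_small u : Prop :=
  forall e : R, 0 < e -> exists N0 : nat, forall N : nat, (N0 <= N)%N ->
    `|\sum_(0 <= n < N) u n| <= e * N%:R.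

(* Up to an error e, only e^(o(L)) words of length L occur in a. *)
Definition deterministic a : Prop :=
  exists2 M : R, 0 < M &
  (forall n, `|a n| <= M) /\
  forall e delta : R, 0 < e -> 0 < delta -> exists L0, forall L, (L0 <= L)%N ->
  exists p (y : nat -> nat -> R),
    [/\ ln p%:R <= delta * L%:R,
        forall i k, `|y i k| <= M
      & forall n, exists2 i, (i < p)%N &
          forall k, (k < L)%N -> `|a (n + k)%N - y i k| <= e].

Lemma sum_smallD u v :
  sum_small u -> sum_small v -> sum_small (fun n => u n + v n).
Proof.
move=> su sv e e0; have e2 : 0 < e / 2 by rewrite divr_gt0.
have [N1 H1] := su _ e2; have [N2 H2] := sv _ e2.
exists (maxn N1 N2) => N; rewrite geq_max => /andP[/H1 h1 /H2 h2].
rewrite big_split /=; apply: (le_trans (ler_normD _ _)); lra.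
Qed.

Lemma sum_smallN u : sum_small u -> sum_small (fun n => - u n).
Proof.
by move=> su e /su[N0 H]; exists N0 => N /H; rewrite sumrN normrN.
Qed.

(** Since [expR (- x) >= 1 - x], it suffices that [(1 - x) * (1 + x + 2 * x ^+ 2) >= 1], which holds
    for [x <= 1/2]. *)
Lemma expR_le_quadratic (x : R) : x <= 2^-1 -> expR x <= 1 + x + 2 * x ^+ 2.
Proof.
move=> hx; have h1 : 1 - x <= expR (- x) by exact: expR_ge1Dx.
have h2 : 0 < expR x by exact: expR_gt0.
have h3 : expR x * expR (- x) = 1 by rewrite -expRD subrr expR0.
have h4 : 1 <= (1 - x) * (1 + x + 2 * x ^+ 2).
  have -> : (1 - x) * (1 + x + 2 * x ^+ 2) = 1 + x ^+ 2 * (1 - 2 * x) by ring.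
  by rewrite lerDl mulr_ge0 ?sqr_ge0 //; lra.
have h5 : 0 <= 1 + x + 2 * x ^+ 2 by nra.
have h6 : 1 <= expR (- x) * (1 + x + 2 * x ^+ 2).
  by apply: (le_trans h4); rewrite ler_wpM2r.
by have := ler_wpM2l (ltW h2) h6; rewrite mulr1 mulrA h3 mul1r.
Qed.

(** Exponential moment of a bounded centred variable: the linear term of the quadratic bound cancels
    because [phi] has sum 0, and [1 + t <= expR t] absorbs the quadratic term. *)
Lemma mgf_le q (phi : nat -> R) (b M lam : R) :
  (forall d, `|phi d| <= 1) -> \sum_(0 <= d < q) phi d = 0 ->
  `|b| <= M -> 0 < lam -> lam * M <= 2^-1 ->
  \sum_(0 <= d < q) expR (lam * (b * phi d)) <= q%:R * expR (2 * (lam * M) ^+ 2).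
Proof.
move=> phi1 phi0 bM lam0 lamM.
have M0 : 0 <= M by apply: le_trans bM.
have bnd d : expR (lam * (b * phi d)) <= expR (2 * (lam * M) ^+ 2) + lam * b * phi d.
  have hb : `|b * phi d| <= M.
    by rewrite normrM -[M]mulr1; apply: ler_pM.
  have hx : `|lam * (b * phi d)| <= lam * M.
    by rewrite normrM gtr0_norm // ler_pM2l.
  have /expR_le_quadratic h : lam * (b * phi d) <= 2^-1.
    by apply: le_trans lamM; apply: le_trans hx; apply: ler_norm.
  apply: (le_trans h); rewrite addrAC mulrA lerD2r.
  apply: le_trans (expR_ge1Dx _); rewrite lerD2l ler_pM2l //.
  by rewrite -mulrA -[leLHS]real_normK ?num_real // lerXn2r // nnegrE // mulr_ge0 // ltW.
apply: (le_trans (ler_sum _ (fun d _ => bnd d))).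
rewrite big_split /= -mulr_sumr phi0 mulr0 addr0 sumr_const_nat subn0.
by rewrite [leRHS]mulr_natl.
Qed.

(* The maximum over the candidate words is controlled by the sum of their
   exponential moments, through [x <= ln A + e^x / A - 1]. *)
Lemma block_sum_le q L p (phi : nat -> R) (M lam : R)
    (y : nat -> nat -> R) (sel : nat -> nat) :
  (0 < q)%N -> (0 < p)%N ->
  (forall d, `|phi d| <= 1) -> \sum_(0 <= d < q) phi d = 0 ->
  (forall i k, `|y i k| <= M) -> 0 < lam -> lam * M <= 2^-1 ->
  (forall v, (sel v < p)%N) ->
  \sum_(0 <= v < q ^ L) \sum_(0 <= k < L) y (sel v) k * phi (digit q v k) <=
  (q ^ L)%:R * (ln p%:R / lam + 2 * lam * M ^+ 2 * L%:R).
Proof.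
move=> q0 p0 phi1 phi0 yM lam0 lamM selp.
have pR : 0 < p%:R :> R by rewrite ltr0n.
set K := 2 * (lam * M) ^+ 2.
pose X i v := \sum_(0 <= k < L) y i k * phi (digit q v k).
have mgf i : \sum_(0 <= v < q ^ L) expR (lam * X i v) <= (q ^ L)%:R * expR (K * L%:R).
  have E v : expR (lam * X i v) =
      \prod_(0 <= k < L) expR (lam * (y i k * phi (digit q v k))).
    by rewrite /X mulr_sumr expR_sum.
  under eq_bigr do rewrite E.
  rewrite (@sum_prod_digit _ q L (fun k d => expR (lam * (y i k * phi d)))) //.
  rewrite [X in _ * X]expRM_natr natrX -exprMn -{2}[L]subn0 -prodr_const_nat.
  apply: ler_prod => k _; rewrite mgf_le // andbT.
  by apply: sumr_ge0 => d _; exact: expR_ge0.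
pose lA := ln p%:R + K * L%:R.
have expA : expR lA = p%:R * expR (K * L%:R) by rewrite expRD lnK // posrE.
have pt v : lam * X (sel v) v <= lA - 1 + expR (lam * X (sel v) v) / expR lA.
  rewrite -expRN -expRD; have := expR_ge1Dx (lam * X (sel v) v - lA); lra.
have tot : \sum_(0 <= v < q ^ L) lam * X (sel v) v <= (q ^ L)%:R * lA.
  apply: (le_trans (ler_sum _ (fun v _ => pt v))).
  rewrite big_split /= -mulr_suml sumr_const_nat subn0 -[(lA - 1) *+ _]mulr_natl mulrBr.
  suff : (\sum_(0 <= v < q ^ L) expR (lam * X (sel v) v)) / expR lA <= (q ^ L)%:R by lra.
  rewrite ler_pdivrMr ?expR_gt0 // expA.
  apply: (@le_trans _ _ (\sum_(0 <= v < q ^ L) \sum_(i < p) expR (lam * X i v))).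
    apply: ler_sum => v _; rewrite (bigD1 (Ordinal (selp v))) //= lerDl.
    by apply: sumr_ge0 => i _; exact: expR_ge0.
  rewrite exchange_big /=.
  apply: (le_trans (ler_sum _ (fun (i : 'I_p) _ => mgf i))).
  by rewrite sumr_const card_ord -[_ *+ p]mulr_natl mulrCA.
rewrite -mulr_sumr in tot.
rewrite -(ler_pM2l lam0); apply: (le_trans tot).
rewrite mulrCA ler_wpM2l ?ler0n // /lA /K.
have -> : lam * (ln p%:R / lam + 2 * lam * M ^+ 2 * L%:R) =
  ln p%:R + 2 * (lam * M) ^+ 2 * L%:R by field; rewrite gt_eqF.
by [].
Qed.

(** The error [e] is split into three parts: approximating [a] by candidate words, the cost
    [ln p / lam] of choosing among [p] words, and the quadratic term of the Chernoff bound. The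
    threshold [L0] is uniform in the shift [s], so it serves for a block at any position. *)
Lemma deterministic_block a q (phi : nat -> R) :
  (0 < q)%N -> (forall d, `|phi d| <= 1) -> \sum_(0 <= d < q) phi d = 0 ->
  deterministic a -> forall e : R, 0 < e ->
  exists L0, forall L, (L0 <= L)%N -> forall s,
  \sum_(0 <= n < q ^ L * L) a (s + n)%N * phi (digit q (n %/ L) (n %% L)) <=
    e * (q ^ L * L)%:R.
Proof.
move=> q0 phi1 phi0 [M M0 [aM det]] e e0.
(* The first bound keeps [lam * M <= 1/2], as the moment estimate requires; the second makes the
   quadratic term at most [e / 3] per letter. *)
pose lam := Num.min (2 * M)^-1 (e / (6 * M ^+ 2)).
have lam0 : 0 < lam.
  by rewrite /lam lt_min invr_gt0 divr_gt0 ?mulr_gt0 ?exprn_gt0.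
have lamM : lam * M <= 2^-1.
  have : lam <= (2 * M)^-1 by rewrite /lam ge_min lexx.
  by rewrite invfM ler_pdivlMr.
have lamM2 : 2 * lam * M ^+ 2 <= e / 3.
  have : lam <= e / (6 * M ^+ 2) by rewrite /lam ge_min lexx orbT.
  have M20 : 0 < M ^+ 2 by rewrite exprn_gt0.
  rewrite ler_pdivlMr ?mulr_gt0 //; lra.
(* The growth rate [lam * e / 3] turns [ln p / lam] into at most [e / 3] per letter. *)
have [||L0 HL] := det (e / 3) (lam * e / 3).
- by rewrite divr_gt0.
- by rewrite !mulr_gt0.
exists L0 => L L0L s; have [p [y [lnp yM yP]]] := HL L L0L.
have p0 : (0 < p)%N by have [i ip _] := yP 0%N; apply: leq_ltn_trans ip.
have selE : forall v, exists i, (i < p)%N /\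
    forall k, (k < L)%N -> `|a (s + v * L + k)%N - y i k| <= e / 3.
  by move=> v; have [i ip H] := yP (s + v * L)%N; exists i.
have [sel selP] := choice selE.
rewrite sum_nat_mul.
have selp v : (sel v < p)%N by case: (selP v).
have := @block_sum_le q L p phi M lam y sel q0 p0 phi1 phi0 yM lam0 lamM selp.
move=> H.
have : \sum_(0 <= v < q ^ L) \sum_(0 <= k < L)
   a (s + (v * L + k))%N * phi (digit q ((v * L + k) %/ L) ((v * L + k) %% L)) <=
   \sum_(0 <= v < q ^ L) \sum_(0 <= k < L) (y (sel v) k * phi (digit q v k) + e / 3).
  apply: ler_sum => v _; rewrite !big_mkord; apply: ler_sum => -[k kL] _ /=.
  have L1 : (0 < L)%N by apply: leq_ltn_trans kL.
  rewrite divnMDl // divn_small // addn0 modnMDl modn_small // addnA.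
  have [_ /(_ k kL) h] := selP v.
  rewrite -lerBlDl -mulrBl; apply: (le_trans (ler_norm _)).
  by rewrite normrM -[leRHS]mulr1; apply: ler_pM.
move/le_trans; apply.
under eq_bigr do rewrite big_split /= sumr_const_nat subn0 -[_ *+ L]mulr_natr.
rewrite big_split /= sumr_const_nat subn0 -[_ *+ (q ^ L)]mulr_natl.
apply: (le_trans (lerD H (lexx _))).
rewrite natrM [leRHS]mulrCA -mulrDr ler_wpM2l ?ler0n //.
have h1 : ln p%:R / lam <= e / 3 * L%:R.
  by rewrite ler_pdivrMr //; lra.
have := ler_wpM2r (ler0n R L) lamM2; lra.
Qed.

(** * Concatenation of blocks whose level grows slowly *)

(** [lev i] is the largest [L <= i] with [L * P L <= i]. This makes a block of level [lev i] short
    compared with [i], hence with everything placed before it. *)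
Lemma slow_levels (P : nat -> nat) : exists lev : nat -> nat,
  (forall i, (lev i * P (lev i) <= i)%N) /\
  forall K, exists i0, forall i, (i0 <= i)%N -> (K <= lev i)%N.
Proof.
pose Q i L := (L <= i)%N && (L * P L <= i)%N.
have Q0 i : exists L, Q i L by exists 0%N.
have Qub i L : Q i L -> (L <= i)%N by case/andP.
exists (fun i => ex_maxn (Q0 i) (Qub i)); split=> [i|K].
  by case: ex_maxnP => L /andP[].
exists (maxn K (K * P K)) => i; rewrite geq_max => /andP[h1 h2].
by case: ex_maxnP => L _; apply; rewrite /Q h1.
Qed.

(** The position is tracked by a pair (block, offset). Nonempty blocks let [next] enter each new
    block at offset 0. *)
Lemma concat_blocks (T : Type) (P : nat -> nat) (B : nat -> nat -> T) :
  (forall i, (0 < P i)%N) ->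
  exists w : nat -> T, forall i k, (k < P i)%N ->
    w (\sum_(0 <= j < i) P j + k)%N = B i k.
Proof.
move=> P0.
pose next (x : nat * nat) :=
  if (x.2.+1 < P x.1)%N then (x.1, x.2.+1) else (x.1.+1, 0%N).
pose pos n := iter n next (0, 0)%N.
suff posE i k : (k < P i)%N -> pos (\sum_(0 <= j < i) P j + k)%N = (i, k).
  by exists (fun n => B (pos n).1 (pos n).2) => i k /posE ->.
elim: i k => [|i IHi] k.
  rewrite big_nil add0n; elim: k => [//|k IHk] h.
  by rewrite /pos /= -/(pos k) IHk 1?ltnW // /next /= h.
elim: k => [_|k IHk h].
  have e : (P i).-1.+1 = P i by rewrite prednK.
  rewrite addn0 big_nat_recr //= -e addnS /pos /= -/(pos _) IHi ?e //.
  by rewrite /next /= e ltnn.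
by rewrite addnS /pos /= -/(pos _) IHk 1?ltnW // /next /= h.
Qed.

Lemma breakpoint_decomp (P : nat -> nat) (N : nat) : (forall i, (0 < P i)%N) ->
  exists i k, (k < P i)%N /\ N = (\sum_(0 <= j < i) P j + k)%N.
Proof.
move=> P0; elim: N => [|N [i [k [kP ->]]]].
  by exists 0%N, 0%N; rewrite big_nil.
case: (ltnP k.+1 (P i)) => h; first by exists i, k.+1; rewrite addnS.
exists i.+1, 0%N; split=> //; rewrite big_nat_recr //= addn0 -addnS.
by congr (_ + _)%N; apply/eqP; rewrite eqn_leq kP.
Qed.

(** Three contributions, each at most [e / 3 * N]: the first [i0] blocks, a fixed sum; the later
    complete blocks, by hypothesis; and the last incomplete block, bounded trivially by [K] times
    its length, which is small compared with [N]. *)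
Lemma sum_le_of_blocks (P lev : nat -> nat) u (K : R) :
  (forall i, (0 < P i)%N) -> (forall i, (lev i * P i <= i)%N) ->
  (forall k, exists i0, forall i, (i0 <= i)%N -> (k <= lev i)%N) ->
  0 < K -> (forall n, `|u n| <= K) ->
  (forall e : R, 0 < e -> exists i0, forall i, (i0 <= i)%N ->
     \sum_(0 <= k < P i) u (\sum_(0 <= j < i) P j + k)%N <= e * (P i)%:R) ->
  forall e : R, 0 < e -> exists N0 : nat, forall N : nat, (N0 <= N)%N ->
    \sum_(0 <= n < N) u n <= e * N%:R.
Proof.
move=> P0 levP levoo K0 uK blk e e0.
pose s i := (\sum_(0 <= j < i) P j)%N.
have sS i : s i.+1 = (s i + P i)%N by rewrite /s big_nat_recr.
have s_ge i : (i <= s i)%N.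
  by elim: i => // i IH; rewrite sS -addn1 leq_add // P0.
have s_mono i j : (i <= j)%N -> (s i <= s j)%N.
  by move=> /subnKC <-; elim: (j - i)%N => [|d IH];
     rewrite ?addn0 // addnS sS (leq_trans IH) ?leq_addr.
have sumcat m p : \sum_(0 <= n < m + p) u n =
    \sum_(0 <= n < m) u n + \sum_(0 <= k < p) u (m + k)%N.
  rewrite (big_cat_nat (leq0n m)) ?leq_addr //=; congr (_ + _).
  rewrite -[X in index_iota X _]add0n big_addn addKn.
  by apply: eq_bigr => k _; rewrite addnC.
have sumK F n : (forall k, `|u (F k)| <= K) -> \sum_(0 <= k < n) u (F k) <= K * n%:R.
  move=> h; apply: (@le_trans _ _ (\sum_(0 <= k < n) K)).
    by apply: ler_sum => k _; apply: le_trans (ler_norm _) _.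
  by rewrite sumr_const_nat subn0 [leRHS]mulr_natr.
have e3 : 0 < e / 3 by rewrite divr_gt0.
have [i0 Hi0] := blk _ e3.
have Hs i : (i0 <= i)%N ->
    \sum_(0 <= n < s i) u n <= K * (s i0)%:R + e / 3 * (s i)%:R.
  move=> /subnKC <-; elim: (i - i0)%N => [|j IH].
    rewrite addn0 -[leLHS]addr0; apply: lerD; first exact: (sumK id).
    by rewrite mulr_ge0 ?ler0n ?(ltW e3).
  rewrite addnS sS sumcat natrD mulrDr addrA.
  by apply: lerD; [exact: IH|apply: Hi0; rewrite leq_addr].
(* Once [lev i >= T], the incomplete block has length at most [N / T], and [K / T <= e / 3]. *)
have [T HT] : exists T : nat, 3 * K / e <= T%:R.
  by exists (Num.trunc (3 * K / e)).+1; apply/ltW/truncnS_gt.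
have [i1 Hi1] := levoo T.
have [N1 HN1] : exists N1 : nat, 3 * K * (s i0)%:R / e <= N1%:R.
  by exists (Num.trunc (3 * K * (s i0)%:R / e)).+1; apply/ltW/truncnS_gt.
exists (maxn N1 (s (maxn i0 i1))) => N; rewrite geq_max => /andP[N1N sN].
have [i [k [kP NE]]] := breakpoint_decomp N P0.
rewrite -/(s i) in NE.
have : (maxn i0 i1 <= i)%N.
  rewrite leqNgt; apply/negP => /s_mono; rewrite sS => h.
  by have := leq_trans h sN; rewrite NE leq_add2l leqNgt kP.
rewrite geq_max => /andP[i0i i1i].
have hTP : (T * P i <= N)%N.
  apply: (@leq_trans (lev i * P i)); first by rewrite leq_mul2r Hi1 ?orbT.
  by apply: leq_trans (levP i) _; rewrite NE; apply: leq_trans (s_ge i) (leq_addr _ _).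
rewrite {1}NE sumcat.
apply: (le_trans (lerD (Hs i i0i) (sumK (fun k => s i + k)%N k (fun=> uK _)))).
have h1 : K * (s i0)%:R <= e / 3 * N%:R.
  have : 3 * K * (s i0)%:R / e <= N%:R by apply: le_trans HN1 _; rewrite ler_nat.
  rewrite ler_pdivrMr //; lra.
have h2 : e / 3 * (s i)%:R <= e / 3 * N%:R.
  by rewrite ler_wpM2l ?ler_nat ?NE ?leq_addr // ltW.
have h3 : K * k%:R <= e / 3 * N%:R.
  have hk : k%:R <= (P i)%:R :> R by rewrite ler_nat ltnW.
  have hT : T%:R * (P i)%:R <= N%:R :> R by rewrite -natrM ler_nat.
  have : 3 * K / e * k%:R <= N%:R.
    apply: le_trans hT; apply: ler_pM; rewrite ?ler0n //.
    by rewrite divr_ge0 ?mulr_ge0 ?(ltW K0) ?(ltW e0).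
  rewrite mulrAC ler_pdivrMr //; lra.
lra.
Qed.

(** * Stability of deterministic sequences and construction of the digit sequence *)

Lemma deterministicN a : deterministic a -> deterministic (\- a).
Proof.
move=> [M M0 [aM det]]; exists M => //; split=> [n|e delta e0 d0].
  by rewrite /= normrN.
have [L0 HL] := det e delta e0 d0; exists L0 => L /HL[p [y [lnp yM yP]]].
exists p, (fun i k => - y i k); split=> // [i k|n]; first by rewrite normrN.
have [i ip H] := yP n; exists i => // k /H; by rewrite /= -opprD normrN.
Qed.

(** With [c = 1], orthogonality to deterministic sequences says that [phi (w n)] itself has mean 0;
    this serves to bound the index from below. *)
Lemma deterministic_cst (c : R) : 0 < c -> deterministic (fun=> c).
Proof.
move=> c0; exists c => //; split=> [n|e delta e0 d0]; first by rewrite gtr0_norm.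
exists 0%N => L _; exists 1%N, (fun _ _ => c); split=> [||n].
- by rewrite ln1 mulr_ge0 ?ler0n ?ltW.
- by move=> *; rewrite gtr0_norm.
- by exists 0%N => // k _; rewrite subrr normr0 ltW.
Qed.

(** A word of length [L] of the grouped sequence is read off a word of length [3 * L] of [a], so the
    same [p] suffices; [delta / 3] compensates for the longer words and [e / 3] for the three
    summands. *)
Lemma deterministic_triple a : deterministic a ->
  deterministic (fun j => a (3 * j)%N + a (3 * j).+1 + a (3 * j).+2).
Proof.
move=> [M M0 [aM det]]; exists (3 * M); first by rewrite mulr_gt0.
have tri (x y z c : R) : `|x| <= c -> `|y| <= c -> `|z| <= c -> `|x + y + z| <= 3 * c.
  move=> h1 h2 h3; apply: (le_trans (ler_normD _ _)).
  have := ler_normD x y; lra.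
split=> [n|e delta e0 d0]; first exact: tri.
have [||L0 HL] := det (e / 3) (delta / 3); rewrite ?divr_gt0 //.
exists L0 => L L0L; have [|p [y [lnp yM yP]]] := HL (3 * L)%N.
  by apply: leq_trans L0L _; rewrite leq_pmull.
exists p, (fun i j => y i (3 * j)%N + y i (3 * j).+1 + y i (3 * j).+2); split=> [|i k|n].
- by apply: le_trans lnp _; rewrite natrM; lra.
- exact: tri.
- have [i ip H] := yP (3 * n)%N; exists i => // k kL.
  have -> : a (3 * (n + k))%N + a (3 * (n + k)).+1 + a (3 * (n + k)).+2 -
     (y i (3 * k)%N + y i (3 * k).+1 + y i (3 * k).+2) =
     (a (3 * n + 3 * k)%N - y i (3 * k)%N) + (a (3 * n + (3 * k).+1)%N - y i (3 * k).+1)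
     + (a (3 * n + (3 * k).+2)%N - y i (3 * k).+2).
    by rewrite !addnS mulnDr; ring.
  have -> : e = 3 * (e / 3) by field.
  by apply: tri; apply: H; lia.
Qed.

Lemma exists_generic_digits q : (0 < q)%N -> exists2 w : nat -> nat,
  (forall n, (w n < q)%N) &
  forall phi a, (forall d, `|phi d| <= 1) -> \sum_(0 <= d < q) phi d = 0 ->
    deterministic a -> sum_small (fun n => a n * phi (w n)).
Proof.
(* The shift to [L.+1] keeps blocks nonempty even where the level is 0. *)
move=> q0; pose P0 L := (q ^ L.+1 * L.+1)%N.
have [lev [levP levoo]] := slow_levels P0.
pose P i := P0 (lev i).
have Ppos i : (0 < P i)%N by rewrite /P /P0 muln_gt0 expn_gt0 q0.
have [w wE] := concat_blocks
  (fun i n => digit q (n %/ (lev i).+1) (n %% (lev i).+1)) Ppos.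
exists w => [n|phi a phi1 phi0 deta].
  by have [i [k [kP ->]]] := breakpoint_decomp n Ppos; rewrite wE // ltn_mod.
have upper b : deterministic b -> forall e : R, 0 < e ->
    exists N0 : nat, forall N : nat, (N0 <= N)%N ->
    \sum_(0 <= n < N) b n * phi (w n) <= e * N%:R.
  move=> detb; have [M M0 [bM _]] := detb.
  apply: (sum_le_of_blocks Ppos levP levoo M0) => [n|e e0].
    by rewrite normrM -[M]mulr1; apply: ler_pM.
  have [L0 HL0] := deterministic_block q0 phi1 phi0 detb e0.
  have [i0 Hi0] := levoo L0; exists i0 => i /Hi0 L0i.
  apply: le_trans (HL0 _ (leqW L0i) (\sum_(0 <= j < i) P j)%N).
  rewrite le_eqVlt; apply/orP; left; apply/eqP.
  by apply: eq_big_nat => k /andP[_ kP]; rewrite wE.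
(* The one-sided bound for [a] and for its negative controls the absolute value. *)
move=> e e0; have [N1 H1] := upper _ deta e e0.
have [N2 H2] := upper _ (deterministicN deta) e e0.
exists (maxn N1 N2) => N; rewrite geq_max => /andP[/H1 h1 /H2 h2].
rewrite ler_norml h1 andbT lerNl; apply: le_trans h2.
by rewrite -sumrN; apply: ler_sum => n _; rewrite /= mulNr.
Qed.

(** At most two terms lie outside the complete triples; their sum is at most [2 * M], absorbed once
    [N >= 4 * M / e]. *)
Lemma sum_small_triple u (M : R) : (forall n, `|u n| <= M) ->
  sum_small (fun j => u (3 * j)%N + u (3 * j).+1 + u (3 * j).+2) -> sum_small u.
Proof.
move=> uM su e e0.
have M0 : 0 <= M by apply: le_trans (uM 0%N).
have e2 : 0 < e / 2 by rewrite divr_gt0.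
have [N0 H0] := su _ e2.
have [T HT] : exists T : nat, 4 * M / e <= T%:R.
  by exists (Num.trunc (4 * M / e)).+1; apply/ltW/truncnS_gt.
exists (maxn (3 * N0) T) => N; rewrite geq_max => /andP[N0N TN].
pose g j := \sum_(0 <= c < 3) u (j * 3 + c)%N.
have gE j : g j = u (3 * j)%N + u (3 * j).+1 + u (3 * j).+2.
  by rewrite /g !big_nat_recr //= big_nil add0r mulnC !addnS addn0.
have NE : N = (N %/ 3 * 3 + N %% 3)%N by exact: divn_eq.
rewrite NE (big_cat_nat (leq0n (N %/ 3 * 3))) ?leq_addr //= -NE sum_nat_mul.
rewrite (eq_bigr _ (fun j _ => gE j)).
apply: (le_trans (ler_normD _ _)).
have h1 : `|\sum_(0 <= j < N %/ 3) (u (3 * j)%N + u (3 * j).+1 + u (3 * j).+2)|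
    <= e / 2 * N%:R.
  apply: (@le_trans _ _ (e / 2 * (N %/ 3)%:R)).
    by apply: H0; rewrite leq_divRL // mulnC.
  by rewrite ler_wpM2l ?(ltW e2) // ler_nat leq_div.
have h2 : `|\sum_(N %/ 3 * 3 <= j < N) u j| <= M * 2.
  apply: (le_trans (ler_norm_sum _ _ _)).
  apply: (@le_trans _ _ (\sum_(N %/ 3 * 3 <= j < N) M)); first exact: ler_sum.
  rewrite sumr_const_nat -[leLHS]mulr_natr ler_wpM2l // ler_nat.
  by rewrite {1}NE addKn -ltnS ltn_mod.
have h3 : 4 * M <= N%:R * e.
  by rewrite -ler_pdivrMr //; apply: le_trans HT _; rewrite ler_nat.
lra.
Qed.

(** Each generic digit is repeated three times. Summing over triples moves the repetition from [w]
    to [a], whose grouped sequence is again deterministic. *)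
Lemma exists_tripled_digits q : (0 < q)%N -> exists w : nat -> nat,
  [/\ forall n, (w n < q)%N, forall n, w n = w (n %/ 3 * 3)%N &
  forall phi a, (forall d, `|phi d| <= 1) -> \sum_(0 <= d < q) phi d = 0 ->
    deterministic a -> sum_small (fun n => a n * phi (w n))].
Proof.
move=> /exists_generic_digits[w wq wP]; exists (fun n => w (n %/ 3)%N); split=> // [n|].
  by rewrite mulnK.
move=> phi a phi1 phi0 deta; have [M M0 [aM _]] := deta.
apply: (@sum_small_triple _ M) => [k|].
  by rewrite normrM -[M]mulr1; apply: ler_pM.
move=> e /(wP _ _ phi1 phi0 (deterministic_triple deta))[N0 H0].
exists N0 => N /H0; congr (`|_| <= _); apply: eq_bigr => j _.
rewrite !mulrDl; congr (_ * phi (w _) + _ * phi (w _) + _ * phi (w _)); lia.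
Qed.

End DeterministicSequences.

(** * Orbits of zero-entropy systems are deterministic *)

Section DynamicsLemmas.
Context {R : realType} {X : metricType R}.
Implicit Types (T : X -> X) (g : X -> R).

(** If [r] is a radius of continuity at [x], then [r / 2] serves at all points within [r / 2] of
    [x]; compactness, in near-covering form, gives a common radius. *)
Lemma compact_unif_continuous g : compact [set: X] -> continuous g ->
  forall e : R, 0 < e -> exists2 d : R, 0 < d &
    forall x y, mdist x y < d -> `|g x - g y| <= e.
Proof.
move=> /compact_near_coveringP cX cg e e0.
have := cX R 0^'+ (fun d x => forall y, mdist x y < d -> `|g x - g y| <= e) _.
case=> [x _|d /= d0 H].
  have /cvgrPdist_lt/(_ (e / 2)) := cg x.
  rewrite divr_gt0 // => /(_ isT)/metricType_numDomainType.nbhs_mdistP[r /= r0 Hr].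
  exists ([set x' | mdist x x' < r / 2], [set d : R | d < r / 2]) => /=.
    split; first by apply/metricType_numDomainType.nbhs_mdistP;
      exists (r / 2); rewrite /= ?divr_gt0.
    by apply: nbhs_right_lt; rewrite divr_gt0.
  move=> [x' d] /= [xx' dr] y x'y.
  have h1 : `|g x - g x'| < e / 2 by apply: Hr => /=; lra.
  have h2 : `|g x - g y| < e / 2.
    apply: Hr => /=; have := metric_triangle x x' y; lra.
  have := ler_distD (g x) (g x') (g y); rewrite (distrC (g x') (g x)); lra.
exists (d / 2); first by rewrite divr_gt0.
move=> x y; apply: (H (d / 2)) => //=; last by rewrite divr_gt0.
by rewrite sub0r normrN gtr0_norm ?divr_gt0 //; lra.
Qed.

Lemma compact_continuous_bounded g : compact [set: X] -> continuous g ->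
  exists2 M : R, 0 < M & forall x, `|g x| <= M.
Proof.
move=> cX cg.
have /compact_bounded[M [_ HM]] : compact (g @` setT).
  by apply: continuous_compact => //; exact: continuous_subspaceT.
exists (Num.max 1 (M + 1)); first by rewrite lt_max ltr01.
move=> x; apply: (HM (Num.max 1 (M + 1))); last by exists x.
by rewrite lt_max ltrDl ltr01 orbT.
Qed.

Lemma entropy0_spanning T : topological_entropy T = 0%E ->
  forall e delta : R, 0 < e -> 0 < delta -> exists n0, forall n, (n0 <= n)%N ->
  exists2 F : {fset X}, spanning T n e F & ln (#|` F|%:R : R) <= delta * n%:R.
Proof.
move=> h0 e delta e0 d0.
set u := (fun n => ((n%:R^-1)%:E * log_spanning_number T n e)%E).
have : (limn_esup u < delta%:E)%E.
  apply: (@le_lt_trans _ _ 0%E); last by rewrite lte_fin.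
  by rewrite -h0; apply: ereal_sup_ubound; exists e.
rewrite /limn_esup /limf_esup => /ereal_inf_lt[_ [V [n0 _ n0V] <-] supV].
(* The successor ensures [n > 0], so that the factor [1 / n] can be cleared. *)
exists n0.+1 => n n0n; have n0R : 0 < n%:R :> R by rewrite ltr0n (leq_trans _ n0n).
have : (u n < delta%:E)%E.
  by apply: le_lt_trans supV; apply: ereal_sup_ubound; exists n => //; apply/n0V/ltnW.
rewrite /u lte_pdivrMl // => /ereal_inf_lt[_ [F spF <-]].
by rewrite -EFinM lte_fin mulrC => /ltW; exists F.
Qed.

(** The candidate words are read along the orbits of an [(L, r)]-spanning set, with [r] from uniform
    continuity of [g]: every [iter n T x] is shadowed for [L] steps by one of its points. *)
Lemma deterministic_orbit T g x : compact [set: X] ->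
  topological_entropy T = 0%E -> continuous g ->
  deterministic (fun n => g (iter n T x)).
Proof.
move=> cX h0 cg; have [M M0 gM] := compact_continuous_bounded cX cg.
exists M => //; split=> // e delta e0 d0.
have [r r0 gr] := compact_unif_continuous cX cg e0.
have [L0 HL] := entropy0_spanning h0 r0 d0.
exists L0 => L /HL[F spF lnF].
exists #|` F|, (fun i k => g (iter k T (nth x (enum_fset F) i))); split=> // n.
have [y yF Hy] := spF (iter n T x).
exists (index y (enum_fset F)); first by rewrite index_mem.
by move=> k kL; rewrite nth_index // addnC iterD; apply/gr/Hy.
Qed.
End DynamicsLemmas.

(** * Complex means through real and imaginary parts *)

Section ComplexMeans.
Context {R : realType}.
Implicit Types (u z : nat -> R[i]).

Lemma Re_sum I (r : seq I) (F : I -> R[i]) :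
  complex.Re (\sum_(i <- r) F i) = \sum_(i <- r) complex.Re (F i).
Proof. by apply: (big_morph _ _ (erefl _)) => -[a b] [c d]. Qed.

Lemma Im_sum I (r : seq I) (F : I -> R[i]) :
  complex.Im (\sum_(i <- r) F i) = \sum_(i <- r) complex.Im (F i).
Proof. by apply: (big_morph _ _ (erefl _)) => -[a b] [c d]. Qed.

Lemma normC_le_parts (x : R[i]) :
  `|x| <= (`|complex.Re x| + `|complex.Im x|)%:C.
Proof.
rewrite normc_def lecR -[leRHS]ger0_norm ?addr_ge0 // -sqrtr_sqr ler_wsqrtr //.
rewrite sqrrD !real_normK ?num_real //.
rewrite -addrA [leRHS]addrCA addrC lerDl.
have := mulr_ge0 (normr_ge0 (complex.Re x)) (normr_ge0 (complex.Im x)); lra.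
Qed.

Lemma gt0_complexE (e : R[i]) : 0 < e -> e = (complex.Re e)%:C /\ 0 < complex.Re e.
Proof. by case: e => a b; rewrite ltcE /= => /andP[/eqP -> ->]. Qed.

Lemma mean_cvg0_of_parts u :
  sum_small (fun n => complex.Re (u n)) -> sum_small (fun n => complex.Im (u n)) ->
  mean_cvg0 u.
Proof.
move=> sRe sIm; apply/cvgrPdist_le => e /gt0_complexE[-> r0].
have r2 : 0 < complex.Re e / 2 by rewrite divr_gt0.
have [N1 H1] := sRe _ r2; have [N2 H2] := sIm _ r2.
exists (maxn N1 N2) => // N /=; rewrite geq_max => /andP[/H1 h1 /H2 h2].
(* At [N = 0] the mean is 0 by the convention that the inverse of 0 is 0. *)
rewrite sub0r normrN; case: N h1 h2 => [|N] h1 h2.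
  by rewrite invr0 mul0r normr0 lecR ltW.
rewrite normrM normfV normr_nat ler_pdivrMl ?ltr0n //.
apply: (le_trans (normC_le_parts _)); rewrite Re_sum Im_sum.
have -> : N.+1%:R = (N.+1%:R : R)%:C :> R[i] by rewrite rmorph_nat.
rewrite -rmorphM /= lecR; apply: (le_trans (lerD h1 h2)).
by rewrite mulrC; lra.
Qed.

Lemma mean_cvg0_Re u : mean_cvg0 u -> sum_small (fun n => complex.Re (u n)).
Proof.
move=> /cvgrPdist_le cu e e0; have [|N0 _ H] := cu e%:C; first by rewrite ltcR.
exists N0 => -[|N] /H.
  by move=> _; rewrite big_nil normr0 mulr0.
rewrite sub0r normrN normrM normfV normr_nat ler_pdivrMl ?ltr0n //.
move/(le_trans (normc_ge_Re _)); rewrite Re_sum.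
have -> : N.+1%:R = (N.+1%:R : R)%:C :> R[i] by rewrite rmorph_nat.
by rewrite -rmorphM /= lecR mulrC.
Qed.

End ComplexMeans.

(** * The Sarnak property for sequences read from digits *)

Section UnimodularSequences.
Context {R : realType}.
Implicit Types (u z : nat -> R[i]) (x : R[i]).

Lemma normc_ge_Im x : `|complex.Im x|%:C <= `|x|.
Proof. by rewrite normc_def lecR -sqrtr_sqr ler_wsqrtr // lerDr sqr_ge0. Qed.

Lemma continuous_Re (X : topologicalType) (f : X -> R[i]^o) :
  continuous f -> continuous (fun t => complex.Re (f t) : R).
Proof.
move=> cf x; apply/cvgrPdist_lt => e e0.
have /cvgrPdist_lt/(_ e%:C) := cf x; rewrite ltcR => /(_ e0); apply: filterS => y.
by move/(le_lt_trans (normc_ge_Re _)); rewrite ltcR raddfB.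
Qed.

Lemma continuous_Im (X : topologicalType) (f : X -> R[i]^o) :
  continuous f -> continuous (fun t => complex.Im (f t) : R).
Proof.
move=> cf x; apply/cvgrPdist_lt => e e0.
have /cvgrPdist_lt/(_ e%:C) := cf x; rewrite ltcR => /(_ e0); apply: filterS => y.
by move/(le_lt_trans (normc_ge_Im _)); rewrite ltcR raddfB.
Qed.

(** Splitting [f] and [psi] into real and imaginary parts leaves four real correlations, each
    between a deterministic sequence and a centred function of the digits. *)
Lemma sarnak_of_digits q (w : nat -> nat) (psi : nat -> R[i]) :
  (forall (phi a : nat -> R), (forall d, `|phi d| <= 1) ->
     \sum_(0 <= d < q) phi d = 0 ->
     deterministic a -> sum_small (fun n => a n * phi (w n))) ->
  (forall d, `|psi d| <= 1) -> \sum_(0 <= d < q) psi d = 0 ->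
  sarnak (fun n => psi (w n)).
Proof.
move=> wP psi1 psi0 X T cX _ h0 f cf x.
have re1 d : `|complex.Re (psi d)| <= 1.
  by rewrite -lecR; apply: le_trans (normc_ge_Re _) (psi1 d).
have im1 d : `|complex.Im (psi d)| <= 1.
  by rewrite -lecR; apply: le_trans (normc_ge_Im _) (psi1 d).
have re0 : \sum_(0 <= d < q) complex.Re (psi d) = 0 by rewrite -Re_sum psi0.
have im0 : \sum_(0 <= d < q) complex.Im (psi d) = 0 by rewrite -Im_sum psi0.
have dre := deterministic_orbit x cX h0 (continuous_Re cf).
have dim := deterministic_orbit x cX h0 (continuous_Im cf).
have ReM (a b : R[i]) : complex.Re (a * b) =
    complex.Re a * complex.Re b + - (complex.Im a * complex.Im b).
  by case: a; case: b.
have ImM (a b : R[i]) : complex.Im (a * b) =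
    complex.Re a * complex.Im b + complex.Im a * complex.Re b.
  by case: a; case: b.
apply: mean_cvg0_of_parts.
  under eq_fun do rewrite ReM.
  apply: sum_smallD; first exact: wP re1 re0 dre.
  by apply: sum_smallN; exact: wP im1 im0 dim.
under eq_fun do rewrite ImM.
apply: sum_smallD; first exact: wP im1 im0 dre.
exact: wP re1 re0 dim.
Qed.

(** * Roots of unity *)

Lemma cexpD (s t : R) : cexp (s + t) = cexp s * cexp t.
Proof.
by rewrite /cexp cosD sinD; simpc; rewrite [X in _ +i* X]addrC.
Qed.

Lemma cexp0 : cexp 0 = 1 :> R[i].
Proof. by rewrite /cexp cos0 sin0. Qed.

Lemma cexpX (t : R) n : cexp t ^+ n = cexp (t * n%:R).
Proof.
elim: n => [|n IH]; first by rewrite mulr0 cexp0.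
by rewrite exprSr IH -cexpD -natr1 mulrDr mulr1.
Qed.

Lemma norm_cexp (t : R) : `|cexp t| = 1.
Proof. by rewrite normc_def /= cos2Dsin2 sqrtr1. Qed.

Lemma cexp_2piM (k : nat) : cexp (2 * pi * k%:R) = 1 :> R[i].
Proof.
by rewrite -cexpX /cexp mulr_natl cos2pi sin2pi expr1n.
Qed.

Lemma U_expr x (m : nat) : (0 < m)%N -> U (Some m) x -> x ^+ m = 1.
Proof.
move=> m0 [k /= _ <-]; rewrite cexpX -mulrA mulVf ?mulr1 ?cexp_2piM //.
by rewrite pnatr_eq0 -lt0n.
Qed.

(** The real part of the power is [cos (2 y) = 1 - 2 sin^2 y] with [y = pi * j / q] strictly between
    0 and [pi], where the sine is positive. *)
Lemma cexp_root_neq1 (q j : nat) : (0 < j < q)%N ->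
  cexp (2 * pi / q%:R) ^+ j != 1 :> R[i].
Proof.
move=> /andP[j0 jq]; apply/eqP; rewrite cexpX.
have q0 : 0 < q%:R :> R by rewrite ltr0n (ltn_trans j0 jq).
pose y := pi * j%:R / q%:R :> R.
have -> : 2 * pi / q%:R * j%:R = y *+ 2 by rewrite /y -mulr_natl; field; rewrite gt_eqF.
move/(congr1 (@complex.Re R)) => /=; rewrite cos_mulr2n cos2sin2.
have : 0 < sin y.
  apply: sin_gt0_pi; rewrite /y divr_gt0 ?mulr_gt0 ?pi_gt0 ?ltr0n ?(ltn_trans j0 jq) //=.
  by rewrite ltr_pdivrMr // ltr_pM2l ?pi_gt0 // ltr_nat.
move=> sy; have := exprn_gt0 2 sy; lra.
Qed.

Lemma sum_expr_root x (q : nat) : x != 1 -> x ^+ q = 1 ->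
  \sum_(0 <= d < q) x ^+ d = 0.
Proof.
move=> x1 xq; have := subrX1 x q; rewrite xq subrr => /esym/eqP.
by rewrite mulf_eq0 subr_eq0 (negbTE x1) /= => /eqP; rewrite big_mkord.
Qed.

(** * Sets of density zero *)

Lemma natr_card_set (A : set nat) (N : nat) :
  #|[pred n : 'I_N | (n : nat) \in A]|%:R =
  \sum_(0 <= n < N) (n \in A)%:R :> R.
Proof.
rewrite -sum1_card natr_sum big_mkcond big_mkord; apply: eq_bigr => i _.
by rewrite inE; case: ifP.
Qed.

Lemma density_zero_le (A : set nat) (e : R) : density_zero A (R := R) -> 0 < e ->
  exists N0 : nat, forall N : nat, (N0 <= N)%N ->
    \sum_(0 <= n < N) (n \in A)%:R <= e * N%:R :> R.
Proof.
move=> /cvgrPdist_le dA e0; have [N0 _ H] := dA e e0.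
exists N0 => -[|N] /H; first by rewrite big_nil mulr0.
rewrite sub0r normrN natr_card_set => /(le_trans (ler_norm _)).
by rewrite ler_pdivrMr ?ltr0n.
Qed.

Lemma density_zero_set0 : density_zero set0 (R := R).
Proof.
apply/cvgrPdist_le => e e0; exists 0%N => // N _ /=.
rewrite natr_card_set big1 ?mul0r ?subrr ?normr0 ?ltW // => i _.
by rewrite in_set0.
Qed.

Lemma not_density_zero_setT : ~ density_zero setT (R := R).
Proof.
move=> /density_zero_le/(_ (_ : 0 < 2^-1))[] // N0 /(_ N0.+1 (leqnSn _)).
under eq_bigr do rewrite in_setT.
rewrite sumr_const_nat subn0 => h.
have : 0 < N0.+1%:R :> R by rewrite ltr0n.
move: h; rewrite -[leLHS]/(N0.+1%:R); lra.
Qed.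

(** Pointwise [u] is at least 1 minus twice the indicator of [A], so its means are eventually at
    least [1 - 2/8], contradicting the bound [1/4]. *)
Lemma density_zero_not_sum_small (A : set nat) (u : nat -> R) :
  density_zero A (R := R) -> sum_small u -> (forall n, -1 <= u n) ->
  (forall n, ~ A n -> u n = 1) -> False.
Proof.
move=> dA su u1 uA.
have [N1 H1] : exists N0 : nat, forall N : nat, (N0 <= N)%N ->
    \sum_(0 <= n < N) (n \in A)%:R <= 8^-1 * N%:R :> R by exact: density_zero_le.
have [|N2 H2] := su 4^-1; first by rewrite invr_gt0.
pose N := (maxn N1 N2).+1.
have := H1 N (leqW (leq_maxl _ _)); have := H2 N (leqW (leq_maxr _ _)).
move=> /(le_trans (ler_norm _)) h2 h1.
have : \sum_(0 <= n < N) (1 - 2 * (n \in A)%:R) <= \sum_(0 <= n < N) u n.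
  apply: ler_sum => n _; case: (boolP (n \in A)) => [_|/negP nA].
    by have := u1 n; rewrite /=; lra.
  by rewrite uA ?mulr0 ?subr0 // => An; apply: nA; rewrite inE.
rewrite big_split /= sumrN -mulr_sumr sumr_const_nat subn0.
have : 0 < N%:R :> R by rewrite ltr0n.
lra.
Qed.

Lemma Re_norm1_ge x : `|x| = 1 -> -1 <= complex.Re x.
Proof.
move=> x1; have := normc_ge_Re x; rewrite x1 (_ : 1 = 1%:C) // lecR => h.
by move: h; rewrite ler_norml => /andP[].
Qed.

Lemma cpow_norm1 x (i : int) : `|x| = 1 -> cpow x i = x ^ i /\ `|cpow x i| = 1.
Proof.
move=> x1; have x0 : x != 0 by rewrite -normr_eq0 x1 oner_eq0.
rewrite /cpow (negbTE x0); split=> //.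
by case: i => n; rewrite /exprz ?normfV normrX x1 expr1n ?invr1.
Qed.

(** * Failure of the Chowla property *)

(** The exponent [e] acts as -1. The product of [z n] and [z n.+1 ^ e] is 1 at two of every three
    indices and has real part at least -1 at the third, so its mean has real part at least [1/3]
    along multiples of 3. *)
Lemma not_chowla_tripled (m : option nat) z (e : int) :
  (forall n, `|z n| = 1) -> (forall n, z n = z (n %/ 3 * 3)%N) ->
  (forall n, z n * z n ^ e = 1) -> exponents m 1 -> exponents m e ->
  ~ chowla m z.
Proof.
move=> z1 z3 ze m1 me ch.
have : mean_cvg0 (fun n => \prod_(k < 2)
    cpow (z (n + k)%N) (if k == ord0 then 1 else e)).
  apply: (ch 2%N (fun k => k : nat) (fun k => if k == ord0 then 1 else e)) => // [k|].
    by case: ifP.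
  by exists ord0.
move/mean_cvg0_Re; set u := (fun n => complex.Re _).
have uE n : u n = complex.Re (z n * z n.+1 ^ e).
  rewrite /u !big_ord_recl big_ord0 /= mulr1 addn0 addn1.
  by rewrite (cpow_norm1 _ (z1 _)).1 (cpow_norm1 _ (z1 _)).1 expr1z.
have u_ge n : -1 <= u n.
  apply: Re_norm1_ge; rewrite normr_prod big1 // => k _.
  exact: (cpow_norm1 _ (z1 _)).2.
have u1 j (c : nat) : (c < 2)%N -> u (j * 3 + c)%N = 1.
  move=> c2; rewrite uE (_ : z _.+1 = z (j * 3 + c)%N) ?ze //.
  by rewrite z3 [RHS]z3; congr z; lia.
clearbody u => /(_ 6^-1)[]; first by rewrite invr_gt0.
move=> N0 /(_ (N0.+1 * 3)%N); rewrite (leq_trans (leqnSn _)) ?leq_pmulr // => /(_ isT).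
move/(le_trans (ler_norm _)); rewrite sum_nat_mul.
have : \sum_(0 <= v < N0.+1) 1 <= \sum_(0 <= v < N0.+1) \sum_(0 <= k < 3) u (v * 3 + k)%N.
  apply: ler_sum => v _; rewrite !big_nat_recr //= big_nil.
  by have := u1 v 0%N isT; have := u1 v 1%N isT; have := u_ge (v * 3 + 2)%N; lra.
rewrite sumr_const_nat subn0 natrM.
have : 0 < N0.+1%:R :> R by rewrite ltr0n.
lra.
Qed.

(** Modulus 1 comes from the 3-4-5 triple. Were it a root of unity, a power of [3 + 4i] would be
    real, which its imaginary part modulo 5 excludes. *)
Definition c345 : R[i] := (3 / 5) +i* (4 / 5).

Lemma norm_c345 : `|c345| = 1.
Proof.
have h : (3 / 5) ^+ 2 + (4 / 5) ^+ 2 = 1 :> R by field.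
by rewrite normc_def /= h sqrtr1.
Qed.

(* Modulo 5 every power of 3 + 4i is congruent to 3 + 4i. *)
Lemma c345_expr_neq1 n : (0 < n)%N -> c345 ^+ n != 1.
Proof.
case: n => // n _.
have [a [b E]] : exists a b : int,
    (3 +i* 4) ^+ n.+1 = (3 + 5 * a)%:~R +i* (4 + 5 * b)%:~R :> R[i].
  elim: n => [|n [a [b IH]]]; first by exists 0, 0; rewrite expr1 !mulr0 !addr0.
  exists (- 2 + 3 * a - 4 * b), (4 + 4 * a + 3 * b); rewrite exprSr IH; simpc.
  by congr (_ +i* _); rewrite !(rmorphD, rmorphB, rmorphM, rmorphN) /=; ring.
apply/eqP => c1.
have : (3 +i* 4) ^+ n.+1 = (5 ^+ n.+1)%:C :> R[i].
  have -> : 3 +i* 4 = 5%:C * c345 :> R[i] by rewrite /c345; simpc; congr (_ +i* _); field.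
  by rewrite exprMn c1 mulr1 rmorphXn.
rewrite E => -[_ /eqP]; rewrite intr_eq0 => /eqP; lia.
Qed.

End UnimodularSequences.

(** * Choice of the sequence and verification of its properties *)

Theorem mainTheorem5 (R : realType) (m : option nat) (hm : admissible m) :
  exists z : nat -> R[i],
    [/\ forall n : nat, (unit_circle `|` [set 0]) (z n),
        has_index z m,
        sarnak z
      & ~ chowla m z].
Proof.
pose q := if m is Some m' then m' else 2%N.
pose c : R[i] := if m is Some _ then 1 else c345.
have q2 : (1 < q)%N by move: hm; rewrite /q; case: (m).
have q0 : (0 < q)%N by exact: ltnW.
have c1 : `|c| = 1 by rewrite /c; case: (m) => [_|]; rewrite ?normr1 ?norm_c345.
pose om : R[i] := cexp (2 * pi / q%:R).
have om1 : `|om| = 1 by exact: norm_cexp.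
have omq : om ^+ q = 1.
  rewrite cexpX divfK ?pnatr_eq0 -?lt0n //.
  by rewrite -[2 * pi]mulr1 (cexp_2piM 1).
have [w [wq w3 wP]] := exists_tripled_digits R q0.
pose z n := c * om ^+ w n.
have z1 n : `|z n| = 1 by rewrite normrM c1 normrX om1 expr1n mulr1.
have zN0 n : z n != 0 by rewrite -normr_eq0 z1 oner_eq0.
exists z; split.
- by move=> n; left; rewrite /unit_circle /= z1.
- split=> //.
  + rewrite /almost_in_U (_ : mkset _ = set0); first exact: density_zero_set0.
    rewrite -subset0 => n /=; apply; left.
    rewrite /U /z /c /om; move: (wq n); rewrite /q; case: (m) => [m'|] wn /=.
      by exists (w n) => //; rewrite mul1r cexpX mulrAC -mulrA mulrC.
    by rewrite /unit_circle /= normrM norm_c345 normrX norm_cexp expr1n mulr1.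
  + move=> [j|]; last by case: (m).
    move=> /= j2 zj.
    have j0 : (0 < j)%N by exact: ltnW.
    have zjE n : ~ ~ (U (Some j) `|` [set 0]) (z n) -> z n ^+ j = 1.
      move=> /contrapT[|/= z0]; first exact: U_expr.
      by have := zN0 n; rewrite z0 eqxx.
    rewrite /index_le; case Em: m => [m'|].
      (* For [j < m], [om ^+ j] is an [m]-th root of unity other than 1, so its powers over all
         digits sum to 0 and [z n ^+ j] has mean 0; but it would equal 1 outside a set of density
         zero. *)
      rewrite leqNgt; apply/negP => jm.
      apply: (density_zero_not_sum_small (u := fun n => complex.Re (z n ^+ j)) zj).
      * have xj : om ^+ j != 1.
          by apply: cexp_root_neq1; rewrite j0 /q Em.
        have zE n : complex.Re (z n ^+ j) = 1 * complex.Re ((om ^+ j) ^+ w n).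
          by rewrite mul1r /z /c Em mul1r exprAC.
        under eq_fun do rewrite zE.
        apply: (wP (fun d => complex.Re ((om ^+ j) ^+ d)) (fun=> 1)).
        -- move=> d; rewrite -lecR; apply: le_trans (normc_ge_Re _) _.
           by rewrite !normrX om1 !expr1n.
        -- by rewrite -Re_sum sum_expr_root // -exprM mulnC exprM omq expr1n.
        -- exact: deterministic_cst.
      * by move=> n; apply: Re_norm1_ge; rewrite normrX z1 expr1n.
      * by move=> n /zjE ->.
    (* For infinite index no [z n] lies in [U (Some j)]: since [om ^+ 2 = 1], this would give
       [c345 ^+ (j * 2) = 1]. The exceptional set is therefore everything. *)
    exfalso; move: zj; rewrite /almost_in_U (_ : mkset _ = setT).
      exact: not_density_zero_setT.
    rewrite -subTset => n _ /= zU.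
    have zj := zjE n (fun h => h zU).
    have om2 : om ^+ 2 = 1 by move: omq; rewrite /q Em.
    have /(c345_expr_neq1 (R := R))/eqP : (0 < j * 2)%N by rewrite muln_gt0 j0.
    apply.
    have -> : c345 = z n / om ^+ w n.
      by rewrite /z /c Em mulfK // expf_neq0 // -normr_eq0 om1 oner_eq0.
    rewrite exprMn exprVn exprM zj expr1n mul1r -exprM mulnA mulnC.
    by rewrite exprM om2 expr1n invr1.
- apply: (sarnak_of_digits (psi := fun d => c * om ^+ d) wP) => [d|].
    by rewrite normrM c1 normrX om1 expr1n mulr1.
  rewrite -mulr_sumr sum_expr_root ?mulr0 //.
  by rewrite -[om]expr1; apply: cexp_root_neq1.
(* For finite [m] the exponent -1 is represented by [m - 1] within the allowed range, as
   [z n ^+ m = 1]. *)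
- pose e : int := if m is Some m' then m'.-1%:Z else -1.
  apply: (not_chowla_tripled (e := e) z1).
  + by move=> n; rewrite /z w3.
  + move=> n; rewrite /e; case Em: m => [m'|].
      rewrite -exprnP -exprS prednK; last by move: q0; rewrite /q Em.
      rewrite /z /c Em mul1r -exprM mulnC exprM.
      by move: omq; rewrite /q Em => ->; rewrite expr1n.
    by rewrite exprN1 mulfV.
  + by move: hm; rewrite /exponents; case: (m) => //= m' h; lia.
  + by move: hm; rewrite /e /exponents; case: (m) => //= m' h; lia.
Qed.
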